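(* Let $\{\mathsf{E}_\alpha\}_{\alpha\in\kappa}$ be a family of logics, where $\kappa$ is an index set of arbitrary cardinality, and let $\mathsf{F}_\kappa$ be the associated set of functions $A:\kappa\to\bigcup_{\alpha\in\kappa}\mathsf{E}_\alpha$ with $A(\alpha)\in\mathsf{E}_\alpha$, in which every function taking the value $\mathbf{0}$ somewhere is identified with the constant function $\hat{\mathbf{0}}$ of value $\mathbf{0}$. Let $(\mathsf{T},\leq,\vee,\wedge,{}^\bullet,\mathbf{0},\mathbf{1})$ be a logic and let $e=\{e_\alpha\}_{\alpha\in\kappa}$ be a family of logic embeddings $e_\alpha:\mathsf{E}_\alpha\to\mathsf{T}$. Assume that the family $\mathfrak{S}_e\subseteq\mathcal{P}(\mathsf{T})$ given by the sets $$S_A=\{e_\alpha(A(\alpha)):\alpha\in\kappa\},\qquad A\in\mathsf{F}_\kappa,$$ is meet-join distributive. Then there exists a unique homomorphism of logics $t:\bigotimes_{\alpha\in\kappa}\mathsf{E}_\alpha\to\mathsf{T}$ such that $$t(\mathfrak{i}_\alpha(a))=e_\alpha(a),\qquad\forall a\in\mathsf{E}_\alpha,\ \forall\alpha\in\kappa.$$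
   Context: A logic is a complete orthocomplemented (not necessarily distributive) lattice. A homomorphism of logics preserves arbitrary suprema and infima, bottom, top and orthocomplement; a logic embedding is an injective homomorphism of logics. Write $(\mathsf{E}_\alpha,\subseteq,\cup,\cap,{}^c,\mathbf{0},\mathbf{1})$. Meet-join distributivity: for a complete lattice $\mathsf{L}$ and $\mathfrak{S}\subseteq\mathcal{P}(\mathsf{L})$, let $\mathcal{C}(\mathfrak{S})=\{f:\mathfrak{S}\to\bigcup_{S\in\mathfrak{S}}S\,:\,f(S)\in S\}$. $\mathfrak{S}$ is meet-join distributive if for every sub-family $\mathfrak{T}\subseteq\mathfrak{S}$, $\bigwedge\{\bigvee S:S\in\mathfrak{T}\}=\bigvee\{\bigwedge\mathrm{Im}f:f\in\mathcal{C}(\mathfrak{T})\}$, with suprema and infima taken in $\mathsf{L}$. The set $\mathsf{F}_\kappa$: functions $A:\kappa\to\bigcup_\alpha\mathsf{E}_\alpha$ with $A(\alpha)\in\mathsf{E}_\alpha$, where each $A$ with $A(\alpha)=\mathbf{0}$ for some $\alpha$ is identified with the constant function $\hat{\mathbf{0}}$ of value $\mathbf{0}$; the identified element is represented by this constant function. $\hat{\mathbf{1}}$ is the constant function of value $\mathbf{1}$. $\mathsf{F}_\kappa$ is a complete lattice under the component-wise order $\subseteq$, with bottom $\hat{\mathbf{0}}$ and top $\hat{\mathbf{1}}$. Tensor product. A term is a function $i\in I\mapsto A^i\in\mathsf{F}_\kappa$, written $\bigsqcup_{i\in I}A^i$, with $|I|\leq2^{|\mathsf{F}_\kappa|}$.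 Put $\bigsqcup_{i\in I}A^i\backsim\bigsqcup_{j\in J}B^j$ iff for every $i\in I$ there is $j\in J$ with $A^i\subseteq B^j$ (if $J=\emptyset$: $A^i=\hat{\mathbf{0}}$), and for every $j\in J$ there is $i\in I$ with $B^j\subseteq A^i$ (if $I=\emptyset$: $B^j=\hat{\mathbf{0}}$). $\mathsf{D}(\mathsf{F}_\kappa)$ is the set of classes of this equivalence relation; classes are always represented by terms with $I\neq\emptyset$. It is ordered by: $[\bigsqcup_{i\in I}A^i]\leq[\bigsqcup_{j\in J}B^j]$ iff for every $i\in I$ there is $j\in J$ with $A^i\subseteq B^j$. With this order $\mathsf{D}(\mathsf{F}_\kappa)$ is a complete (completely distributive) lattice, with suprema $\bigvee$ and infima $\bigwedge$; $\mathsf{F}_\kappa\subseteq\mathsf{D}(\mathsf{F}_\kappa)$ via $A\mapsto[A]$, and every element is a supremum $[\bigsqcup_{i\in I}A^i]=\bigvee_{i\in I}A^i$ with $I\neq\emptyset$, $A^i\in\mathsf{F}_\kappa$. The (well-defined, order-reversing) function $*$ on $\mathsf{D}(\mathsf{F}_\kappa)$ is $$\Big(\bigvee_{i\in I}A^i\Big)^*=\bigvee_{f:I\to\kappa}\mathbb{A}_{f,I},\qquad\mathbb{A}_{f,I}(\alpha)=\bigcap_{i\,:\,f(i)=\alpha}(A^i(\alpha))^c$$ (an empty meet is $\mathbf{1}$). The tensor product is $\bigotimes_{\alpha\in\kappa}\mathsf{E}_\alpha=\{\mathbb{A}\in\mathsf{D}(\mathsf{F}_\kappa):\mathbb{A}=\mathbb{A}^{**}\}$;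 with the inherited order it contains $\mathsf{F}_\kappa$ and is a logic with the same infima as $\mathsf{D}(\mathsf{F}_\kappa)$, bottom $\hat{\mathbf{0}}$, top $\hat{\mathbf{1}}$, supremum $\coprod S=(\bigvee S)^{**}$ and orthocomplementation $*$. The map $\mathfrak{i}_\alpha:\mathsf{E}_\alpha\to\mathsf{F}_\kappa\subseteq\bigotimes_{\beta\in\kappa}\mathsf{E}_\beta$ is $(\mathfrak{i}_\alpha(a))(\beta)=a$ if $\beta=\alpha$ and $\mathbf{1}$ if $\beta\neq\alpha$.
   Formalization: The index set is assumed non-empty, and if some factor has no element besides 0 and 1, the sets S_A for all functions A (before the identification with the zero function) are also assumed meet-join distributive; without these the claim is false. *)

(* Defs.v *)
From HB Require Import structures.
From mathcomp Require Import all_boot all_order.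
From mathcomp Require Import boolp classical_sets.

Set Implicit Arguments.
Unset Strict Implicit.
Unset Printing Implicit Defensive.

Import Order.TTheory.
Local Open Scope quotient_scope.
Local Open Scope classical_set_scope.
Local Open Scope order_scope.

HB.mixin Record TBLattice_isComplete d T of Order.TBLattice d T := {
  csup : set T -> T;
  cinf : set T -> T;
  csupP : forall S : set T, supremums S (csup S);
  cinfP : forall S : set T, infimums S (cinf S)
}.

#[short(type="completeLatticeType")]
HB.structure Definition CompleteLattice d :=
  { T of Order.TBLattice d T & TBLattice_isComplete d T }.

HB.factory Record POrder_isCompleteLattice d T of Order.POrder d T := {
  csup : set T -> T;
  cinf : set T -> T;
  csupP : forall S : set T, supremums S (csup S);
  cinfP : forall S : set T, infimums S (cinf S)
}.

HB.builders Context d T of POrder_isCompleteLattice d T.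

Let le_bot x : csup set0 <= x :> T.
Proof. by case: (csupP set0) => _; apply. Qed.
HB.instance Definition _ := @Order.hasBottom.Build d T (csup set0) le_bot.

Let ge_top x : x <= cinf set0 :> T.
Proof. by case: (cinfP set0) => _; apply. Qed.
HB.instance Definition _ := @Order.hasTop.Build d T (cinf set0) ge_top.

Let meetP x y z : (x <= cinf [set y; z]) = (x <= y) && (x <= z) :> bool.
Proof.
case: (cinfP [set y; z]) => lb glb; apply/idP/andP => [xle|[xy xz]].
  by split; apply: (le_trans xle); apply: lb; [left|right].
by apply: glb => t [->|->].
Qed.

Let joinP x y z : (csup [set x; y] <= z) = (x <= z) && (y <= z) :> bool.
Proof.
case: (csupP [set x; y]) => ub lub; apply/idP/andP => [xle|[xy xz]].
  by split; apply: (le_trans _ xle); apply: ub; [left|right].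
by apply: lub => t [->|->].
Qed.

HB.instance Definition _ :=
  @Order.POrder_MeetJoin_isLattice.Build d T _ _ meetP joinP.
HB.instance Definition _ :=
  @TBLattice_isComplete.Build d T csup cinf csupP cinfP.
HB.end.

HB.mixin Record TBLattice_hasOrtho d T of Order.TBLattice d T := {
  ortho : T -> T;
  orthoK : involutive ortho;
  le_ortho : forall x y : T, x <= y -> ortho y <= ortho x;
  meetxo : forall x : T, Order.meet x (ortho x) = \bot;
  joinxo : forall x : T, Order.join x (ortho x) = \top
}.

#[short(type="logicType")]
HB.structure Definition Logic d :=
  { T of CompleteLattice d T & TBLattice_hasOrtho d T }.

Section CompleteLatticeTheory.
Context (d : Order.disp_t) (L : completeLatticeType d).
Implicit Types (S : set L) (x : L).

Lemma csup_ub S x : S x -> x <= csup S.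
Proof. by case: (csupP S) => ub _; exact: ub. Qed.

Lemma csup_le S x : (forall y, S y -> y <= x) -> csup S <= x.
Proof. by case: (csupP S) => _; apply. Qed.

Lemma cinf_lb S x : S x -> cinf S <= x.
Proof. by case: (cinfP S) => lb _; exact: lb. Qed.

Lemma le_cinf S x : (forall y, S y -> x <= y) -> x <= cinf S.
Proof. by case: (cinfP S) => _; apply. Qed.

End CompleteLatticeTheory.

Section Morphisms.
Context (d d' : Order.disp_t) (L : logicType d) (M : logicType d').

Definition logic_hom (f : L -> M) : Prop :=
  [/\ forall S : set L, f (csup S) = csup (f @` S),
      forall S : set L, f (cinf S) = cinf (f @` S),
      f \bot = \bot,
      f \top = \top
    & forall x, f (ortho x) = ortho (f x)].

Definition logic_embedding (f : L -> M) : Prop := logic_hom f /\ injective f.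

End Morphisms.

Section MeetJoinDistributivity.
Context (d : Order.disp_t) (L : completeLatticeType d).

Definition choice_functions (TT : set (set L)) : set (TT -> L) :=
  [set f | forall S : TT, (val S) (f S)].
Arguments choice_functions : clear implicits.

Definition meet_join_distributive (SS : set (set L)) : Prop :=
  forall TT : set (set L), TT `<=` SS ->
    cinf [set csup S | S in TT] =
    csup [set cinf (range f) | f in choice_functions TT].

End MeetJoinDistributivity.

Section Tensor.
Context (d : Order.disp_t) (kappa : Type) (E : kappa -> logicType d).

(* The functions that vanish somewhere are identified with the constant
   function \bot; each class is encoded by its canonical representative, so
   that only the constant function \bot is allowed to vanish. *)
Record Fk := MkFk {
  Fval :> forall a, E a;
  Fval_eq0 : (exists a, Fval a = \bot) -> forall a, Fval a = \bot
}.

Lemma Fk_inj (A B : Fk) : (forall a, A a = B a) -> A = B.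
Proof.
case: A B => [A hA] [B hB] /= AB.
have {}AB : A = B by apply: functional_extensionality_dep.
by rewrite AB in hA *; congr MkFk; exact: Prop_irrelevance.
Qed.

Lemma Fk0_subproof :
  (exists a : kappa, \bot = \bot :> E a) -> forall a, \bot = \bot :> E a.
Proof. by []. Qed.
Definition Fk0 : Fk := MkFk Fk0_subproof.

Lemma toFk_subproof (A : forall a, E a) :
  ~ (exists a, A a = \bot) -> (exists a, A a = \bot) -> forall a, A a = \bot.
Proof. by move=> nA /nA. Qed.

Definition toFk (A : forall a, E a) : Fk :=
  match pselect (exists a, A a = \bot) with
  | left _ => Fk0
  | right nA => MkFk (toFk_subproof nA)
  end.

Definition Fle (A B : Fk) : Prop := forall a, A a <= B a.

Lemma Fle_refl A : Fle A A. Proof. by move=> a. Qed.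

Lemma Fle_trans B A C : Fle A B -> Fle B C -> Fle A C.
Proof. by move=> AB BC a; exact: le_trans (AB a) (BC a). Qed.

Lemma Fle0 A : Fle Fk0 A. Proof. by move=> a; exact: le0x. Qed.

Lemma Fle_eq0 A : Fle A Fk0 -> A = Fk0.
Proof. by move=> A0; apply: Fk_inj => a; apply/eqP; rewrite -lex0; exact: A0. Qed.

Lemma Fk_bot (A : Fk) a : A a = \bot -> A = Fk0.
Proof. by move=> Aa; apply: Fk_inj; apply: Fval_eq0; exists a. Qed.

Lemma toFk0 (A : forall a, E a) : (exists a, A a = \bot) -> toFk A = Fk0.
Proof. by rewrite /toFk; case: pselect. Qed.

Lemma toFk_id (A : forall a, E a) :
  ~ (exists a, A a = \bot) -> forall b, toFk A b = A b.
Proof. by rewrite /toFk; case: pselect. Qed.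

Lemma toFk_le (A : forall a, E a) b : toFk A b <= A b.
Proof. by rewrite /toFk; case: pselect => // _; exact: le0x. Qed.

Lemma le_toFk (C : Fk) (A : forall a, E a) :
  (forall a, C a <= A a) -> Fle C (toFk A).
Proof.
move=> CA; rewrite /toFk; case: pselect => [[a Aa]|//].
have -> : C = Fk0; last exact: Fle0.
by apply: (@Fk_bot _ a); apply/eqP; rewrite -lex0 -Aa; exact: CA.
Qed.

(* Index sets of cardinality at most 2^|F| are, up to bijection, the sets of
   subsets of F. *)
Record term := Term {
  idx : set (set Fk);
  fam :> idx -> Fk
}.

(* The second alternative is the convention for an empty right-hand index
   set; it never applies when the right-hand index set is non-empty. *)
Definition term_le (s t : term) : Prop :=
  forall i : idx s,
    (exists j : idx t, Fle (s i) (t j)) \/ (idx t = set0 /\ s i = Fk0).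

Definition term_equiv (s t : term) : Prop := term_le s t /\ term_le t s.

(* The down-set generated by a term (together with 0). *)
Definition below (t : term) : set Fk :=
  [set C | C = Fk0 \/ exists i : idx t, Fle C (t i)].

Lemma term_leE s t : term_le s t <-> below s `<=` below t.
Proof.
split=> [st C [->|[i Ci]]|st i].
- by left.
- case: (st i) => [[j ij]|[_ i0]]; first by right; exists j; exact: Fle_trans ij.
  by left; apply: Fle_eq0; rewrite -i0.
- have [s0|[j ij]] := st _ (or_intror (ex_intro _ i (Fle_refl (s i)))).
    have [t0|/set0P[U tU]] := eqVneq (idx t) set0; first by right.
    by left; exists (exist _ U (mem_set tU)); rewrite s0; exact: Fle0.
  by left; exists j.
Qed.

HB.instance Definition _ := gen_eqMixin term.
HB.instance Definition _ := gen_choiceMixin term.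

Definition term_eqb : rel term := fun s t => `[< term_equiv s t >].

Lemma term_eqb_refl : reflexive term_eqb.
Proof. by move=> s; apply/asboolP; split; apply/term_leE. Qed.

Lemma term_eqb_sym : symmetric term_eqb.
Proof. by move=> s t; apply/asboolP/asboolP => -[]. Qed.

Lemma term_eqb_trans : transitive term_eqb.
Proof.
move=> t s u /asboolP[/term_leE st /term_leE ts] /asboolP[/term_leE tu /term_leE ut].
by apply/asboolP; split; apply/term_leE; [exact: subset_trans tu|exact: subset_trans ts].
Qed.

Canonical term_equiv_rel :=
  EquivRel term_eqb term_eqb_refl term_eqb_sym term_eqb_trans.

Definition DF : Type := {eq_quot term_eqb}.
HB.instance Definition _ := Choice.on DF.
HB.instance Definition _ := EqQuotient.on DF.

Definition class_of (t : term) : DF := \pi_DF t.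

Definition down (X : DF) : set Fk := below (repr X).

Lemma class_ofE s t : class_of s = class_of t <-> term_equiv s t.
Proof.
by split=> [/eqmodP/asboolP|st] //; apply/eqmodP/asboolP.
Qed.

Lemma down_class t : down (class_of t) = below t.
Proof.
have /class_ofE[/term_leE ? /term_leE ?] : class_of (repr (class_of t)) = class_of t.
  by rewrite /class_of reprK.
by apply/seteqP; split.
Qed.

Definition DF_le (X Y : DF) : bool := `[< term_le (repr X) (repr Y) >].

Lemma DF_leE X Y : DF_le X Y <-> down X `<=` down Y.
Proof. by rewrite -term_leE; split => /asboolP. Qed.

Lemma DF_le_class s t : DF_le (class_of s) (class_of t) <-> term_le s t.
Proof. by rewrite DF_leE !down_class term_leE. Qed.

Lemma DF_le_refl : reflexive DF_le.
Proof. by move=> X; apply/DF_leE. Qed.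

Lemma DF_le_anti : antisymmetric DF_le.
Proof.
move=> X Y /andP[/asboolP XY /asboolP YX].
by rewrite -[X]reprK -[Y]reprK; apply/class_ofE.
Qed.

Lemma DF_le_trans : transitive DF_le.
Proof.
by move=> Y X Z /DF_leE XY /DF_leE YZ; apply/DF_leE; exact: subset_trans YZ.
Qed.

HB.instance Definition _ :=
  Order.Le_isPOrder.Build d DF DF_le_refl DF_le_anti DF_le_trans.

Lemma le_down (X Y : DF) : X <= Y <-> down X `<=` down Y.
Proof. exact: DF_leE. Qed.

(* The term listing the elements of a set P of elements of F, indexed by the
   singletons [set A], A in P. *)
Lemma set_term_subproof (P : set Fk) (U : [set [set A] | A in P]) :
  exists A, P A /\ val U = [set A].
Proof. by case: U => U /= /set_mem[A PA <-]; exists A. Qed.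

Definition set_term (P : set Fk) : term :=
  @Term [set [set A] | A in P] (fun U => sval (cid (set_term_subproof U))).

Lemma below_set_term P C : below (set_term P) C <-> C = Fk0 \/ exists2 A, P A & Fle C A.
Proof.
split=> -[->|]; try by left.
  move=> [i]; rewrite /=; case: cid => A [PA _] /= CA; by right; exists A.
move=> [A PA CA]; right.
have PA' : [set A] \in [set [set A] | A in P] by apply/mem_set; exists A.
exists (exist _ [set A] PA') => /=; case: cid => B [PB /= AB] /=.
by have -> : B = A by have : [set B] B by []; rewrite -AB.
Qed.

Lemma down0 X : down X Fk0. Proof. by left. Qed.

Lemma down_le X A C : down X A -> Fle C A -> down X C.
Proof.
move=> [->|[i Ai] CA]; first by move/Fle_eq0 => ->; left.
by right; exists i; exact: Fle_trans Ai.
Qed.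

Definition DF_sup (S : set DF) : DF :=
  class_of (set_term [set A | exists2 X, S X & down X A]).

Definition DF_inf (S : set DF) : DF :=
  class_of (set_term [set A | forall X, S X -> down X A]).

Lemma down_sup S C : down (DF_sup S) C <-> C = Fk0 \/ exists2 X, S X & down X C.
Proof.
rewrite /DF_sup down_class below_set_term; split=> -[->|]; try by left.
  by move=> [A [X SX XA] CA]; right; exists X => //; exact: down_le CA.
by move=> [X SX XC]; right; exists C; [exists X|exact: Fle_refl].
Qed.

Lemma down_inf S C : down (DF_inf S) C <-> forall X, S X -> down X C.
Proof.
rewrite /DF_inf down_class below_set_term; split.
  by move=> [-> X _|[A SA CA] X SX]; [exact: down0|exact: down_le (SA _ SX) CA].
by move=> SC; right; exists C => //; exact: Fle_refl.
Qed.

Lemma DF_supP S : supremums S (DF_sup S).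
Proof.
split=> [X SX|Y Yub]; apply/le_down => C.
  by move=> XC; apply/down_sup; right; exists X.
by move=> /down_sup[->|[X /Yub /le_down XY /XY]//]; exact: down0.
Qed.

Lemma DF_infP S : infimums S (DF_inf S).
Proof.
split=> [X SX|Y Ylb]; apply/le_down => C; first by move/down_inf; exact.
by move=> YC; apply/down_inf => X SX; move/le_down : (Ylb _ SX); exact.
Qed.

HB.instance Definition _ := POrder_isCompleteLattice.Build d DF DF_supP DF_infP.

Definition inDF (A : Fk) : DF := class_of (@Term [set setT] (fun=> A)).

Lemma down_inDF A C : down (inDF A) C <-> Fle C A.
Proof.
rewrite /inDF down_class; split=> [[->|[_]//]|CA]; first exact: Fle0.
by right; exists (exist _ setT (mem_set erefl)).
Qed.

Lemma class_of_sup t : class_of t = csup [set inDF (t i) | i in [set: idx t]].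
Proof.
apply/le_anti/andP; split; last first.
  apply: csup_le => _ [i _ <-]; apply/le_down => C /down_inDF Ci.
  by rewrite down_class; right; exists i.
apply/le_down => C; rewrite down_class => -[->|[i Ci]]; first exact: down0.
have : inDF (t i) <= csup [set inDF (t i) | i in [set: idx t]].
  by apply: csup_ub; exists i.
by move/le_down; apply; exact/down_inDF.
Qed.

Definition star_fun (t : term) (f : idx t -> kappa) : Fk :=
  toFk (fun a => cinf [set ortho (t i a) | i in [set i | f i = a]]).

Definition star_term (t : term) : DF :=
  csup [set inDF (star_fun f) | f in [set: idx t -> kappa]].

(* If repr X has an empty index set, then X is the bottom of D(F) and the formula
   still gives the right value: the only f is the empty function, whose star_fun
   is constantly \top.  By star_class below any other representative may be used. *)
Definition star (X : DF) : DF := star_term (repr X).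

Lemma down_star_term t C : down (star_term t) C <->
  C = Fk0 \/ forall A, below t A -> A = Fk0 \/ exists a, C a <= ortho (A a).
Proof.
split.
  move=> /down_sup[->|[_ [f _ <-] /down_inDF Cf]]; first by left.
  right=> A [->|[i Ai]]; [by left|right; exists (f i)].
  apply: le_trans (le_ortho _ _ (Ai (f i))).
  apply: le_trans (Cf (f i)) _; apply: le_trans (toFk_le _ _) _.
  by apply: cinf_lb; exists i.
move=> [->|CA]; first exact: down0.
have [->|C0] := pselect (C = Fk0); first exact: down0.
have h (i : idx t) : exists a, C a <= ortho (t i a).
  have [|ti0|//] := CA (t i).
    by right; exists i; exact: Fle_refl.
  have [[a]|nk] := pselect (inhabited kappa).
    by exists a; rewrite ti0 /= -(orthoK (C a)); apply: le_ortho; exact: le0x.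
  by case: C0; apply: Fk_inj => a; case: nk.
apply/down_sup; right; exists (inDF (star_fun (fun i => sval (cid (h i))))).
  by exists (fun i => sval (cid (h i))).
apply/down_inDF/le_toFk => a; apply: le_cinf => _ [i /= fia <-].
by case: cid fia => b /= Cb ba; subst b.
Qed.

Lemma star_class t : star (class_of t) = star_term t.
Proof.
have /class_ofE[/term_leE st /term_leE ts] : class_of (repr (class_of t)) = class_of t.
  by rewrite /class_of reprK.
rewrite /star; apply/le_anti/andP; split; apply/le_down => C;
  rewrite !down_star_term => -[->|CA]; by [left|right=> A ?; apply: CA; auto].
Qed.

Lemma down_star X C : down (star X) C <->
  C = Fk0 \/ forall A, down X A -> A = Fk0 \/ exists a, C a <= ortho (A a).
Proof. by rewrite /star down_star_term. Qed.

Lemma star_anti X Y : X <= Y -> star Y <= star X.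
Proof.
move/le_down => XY; apply/le_down => C; rewrite !down_star => -[->|CY]; first by left.
by right => A /XY; exact: CY.
Qed.

Lemma le_star2 X : X <= star (star X).
Proof.
apply/le_down => C XC; apply/down_star; right => A /down_star[->|AX]; first by left.
have [->|[a Aa]] := AX C XC; last first.
  by right; exists a; rewrite -(orthoK (C a)); apply: le_ortho.
have [[a]|nk] := pselect (inhabited kappa); first by right; exists a; exact: le0x.
by left; apply: Fk_inj => a; case: nk.
Qed.

Lemma star3 X : star (star (star X)) = star X.
Proof. by apply/le_anti; rewrite star_anti ?le_star2. Qed.

Record tensor := MkTensor {
  tensor_val :> DF;
  tensor_closed : star (star tensor_val) == tensor_val
}.

HB.instance Definition _ := [isSub for tensor_val].
HB.instance Definition _ := [Choice of tensor by <:].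
HB.instance Definition _ := [SubChoice_isSubPOrder of tensor by <: with d].

Implicit Types (X Y : DF) (x y : tensor).

Lemma star2_tensor x : star (star x) = x. Proof. exact/eqP/tensor_closed. Qed.

Lemma star2_closed X : star (star (star (star X))) == star (star X).
Proof. by rewrite star3. Qed.

Definition tensor_sup (S : set tensor) : tensor :=
  MkTensor (star2_closed (csup [set tensor_val x | x in S])).

Lemma tensor_inf_subproof (S : set tensor) :
  let X := cinf [set tensor_val x | x in S] in star (star X) == X.
Proof.
apply/eqP/le_anti; rewrite le_star2 andbT; apply: le_cinf => _ [x Sx <-].
by rewrite -[leRHS]star2_tensor; do 2!apply: star_anti; apply: cinf_lb; exists x.
Qed.

Definition tensor_inf (S : set tensor) : tensor :=
  MkTensor (tensor_inf_subproof S).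

Lemma tensor_supP S : supremums S (tensor_sup S).
Proof.
split=> [x Sx|y ub]; rewrite -[_ <= _]/(tensor_val _ <= tensor_val _) /=.
  by apply: le_trans (le_star2 _); apply: csup_ub; exists x.
rewrite -[leRHS]star2_tensor; do 2!apply: star_anti.
by apply: csup_le => _ [x Sx <-]; exact: ub.
Qed.

Lemma tensor_infP S : infimums S (tensor_inf S).
Proof.
split=> [x Sx|y lb]; rewrite -[_ <= _]/(tensor_val _ <= tensor_val _) /=.
  by apply: cinf_lb; exists x.
by apply: le_cinf => _ [x Sx <-]; exact: lb.
Qed.

HB.instance Definition _ :=
  POrder_isCompleteLattice.Build d tensor tensor_supP tensor_infP.

Lemma star_closed x : star (star (star x)) == star x.
Proof. by rewrite star3. Qed.

Definition tensor_ortho x : tensor := MkTensor (star_closed x).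

Lemma tensor_orthoK : involutive tensor_ortho.
Proof. by move=> x; apply: val_inj; exact: star2_tensor. Qed.

Lemma le_tensor_ortho x y : x <= y -> tensor_ortho y <= tensor_ortho x.
Proof. exact: star_anti. Qed.

Lemma meet_tensor_ortho x : Order.meet x (tensor_ortho x) = \bot.
Proof.
apply/eqP; rewrite -lex0.
set m := Order.meet _ _.
have mx : m <= x by exact: leIl.
have mo : m <= tensor_ortho x by exact: leIr.
rewrite -[_ <= _]/(tensor_val m <= tensor_val \bot).
move: mx mo.
rewrite -[m <= x]/(tensor_val m <= tensor_val x).
rewrite -[m <= _]/(tensor_val m <= star x) => /le_down mx /le_down mo.
apply/le_down => C mC; have xC := mx _ mC.
move: (mo _ mC) => /down_star[->|/(_ _ xC)[->|[a Ca]]]; try exact: down0.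
have /Fk_bot -> : C a = \bot; last exact: down0.
by apply/eqP; rewrite -lex0 -(meetxo (C a)) lexI lexx.
Qed.

Lemma join_tensor_ortho x : Order.join x (tensor_ortho x) = \top.
Proof.
apply/eqP; rewrite -le1x; set j := Order.join _ _.
have : tensor_ortho j <= \bot.
  rewrite -(meet_tensor_ortho (tensor_ortho x)) lexI tensor_orthoK.
  rewrite le_tensor_ortho ?leUl //= -[leRHS]tensor_orthoK.
  by rewrite le_tensor_ortho // leUr.
move/le_tensor_ortho; rewrite tensor_orthoK => h; apply: le_trans h.
by rewrite -[leLHS]tensor_orthoK le_tensor_ortho // le0x.
Qed.

HB.instance Definition _ := TBLattice_hasOrtho.Build d tensor
  tensor_orthoK le_tensor_ortho meet_tensor_ortho join_tensor_ortho.

Definition single a (x : E a) : forall b, E b :=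
  @dfwith {classic kappa} (fun b => E b : Type) (fun b => \top) a x.

Lemma single_in a (x : E a) : single x a = x.
Proof. exact: dfwith_in. Qed.

Lemma single_out a (x : E a) b : a <> b -> single x b = \top.
Proof. by move=> ab; apply: dfwith_out; apply/eqP. Qed.

Lemma inDF_closed A : star (star (inDF A)) == inDF A.
Proof.
apply/eqP/le_anti; rewrite le_star2 andbT; apply/le_down => C.
move=> /down_star[->|CA]; first exact: down0.
have [->|C0] := pselect (C = Fk0); first exact: down0.
apply/down_inDF => a; set f := single (ortho (A a)).
have fbot b : f b = \bot -> C a <= A a.
  have [<-|/single_out fbE] := pselect (a = b).
    rewrite /f single_in => fb.
    by rewrite -(orthoK (A a)) fb -(orthoK (C a)) le_ortho// le0x.
  rewrite /f fbE => tb; case: C0; apply: (@Fk_bot _ b); apply/eqP.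
  by rewrite -lex0 -tb lex1.
have [[b /fbot//]|nf] := pselect (exists b, f b = \bot).
have [|f0|[b]] := CA (toFk f).
- apply/down_star; right => B /down_inDF BA; right; exists a.
  by apply: le_trans (toFk_le _ _) _; rewrite /f single_in; apply: le_ortho; exact: BA.
- by apply: (fbot a); rewrite -toFk_id // f0.
- rewrite toFk_id //; have [<-|/single_out fbE] := pselect (a = b).
    by rewrite /f single_in orthoK.
  rewrite /f fbE => Cb; case: C0; apply: (@Fk_bot _ b); apply/eqP.
  by rewrite -lex0 (le_trans Cb) // -[leRHS]orthoK le_ortho // lex1.
Qed.

Definition in_tensor (A : Fk) : tensor := MkTensor (inDF_closed A).

Definition tensor_inj a (x : E a) : tensor := in_tensor (toFk (single x)).

(* S_ e A is the set { e_a (A a) }.  It depends on the function A itself, not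
   only on toFk A: if A vanishes at some, but not all, indices, then S_ e A is in
   general different from S_ e (toFk A) = [set \bot].  If every factor has an
   element other than \bot and \top, meet-join distributivity of the sets S_ e A
   for A in F implies that of the sets S_ e A for all functions A (replace the
   vanishing components by x or by ortho x, with x different from \bot and \top,
   in all possible ways).  If some factor is {\bot, \top}, it implies nothing:
   S_ e A contains \top for every A in F other than Fk0. *)
Definition S_ (d' : Order.disp_t) (T : logicType d') (e : forall a, E a -> T)
  (A : forall a, E a) : set T := range (fun a => e a (A a)).

End Tensor.

(* Main.v *)
Require Import Defs.
From mathcomp Require Import all_boot all_order.
From mathcomp Require Import boolp classical_sets.

(** Every element of the tensor product is the supremum of the product
    elements [A] below it, and each [A] is the infimum of the elements
    [tensor_inj (A a)].  A homomorphism extending the embeddings is therefore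
    forced to be [X |-> sup_(A in X) inf_a e a (A a)], which is [extension]
    below; this gives uniqueness.

    For existence, [extension] preserves suprema of [DF E] for the simple reason
    that the down-set of a supremum is a union.  Suprema of the tensor product
    are biorthogonals of those, and infima are obtained from suprema by De
    Morgan, so everything rests on [extension_star]: the map sends [star] to the
    orthocomplement.  By De Morgan
    [ortho (extension X) = inf_(A in X) sup_a e a (ortho (A a))], and exchanging
    inf and sup turns this into the supremum, over all [g] assigning an index to
    each [A], of [inf_A e (g A) (ortho (A (g A)))].  Grouping the [A] according
    to the value of [g A], and using that each [e a] preserves infima, one
    recognises the value of the map at the product elements whose supremum is
    [star X].

    The functions [a |-> ortho (A a)] in this exchange vanish wherever [A a] is
    [\top], so they need not represent elements of [Fk E].  If some factor is
    two-valued, distributivity over such functions is a hypothesis.  If each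
    factor has an element [x] other than [\bot] and [\top], it follows from
    distributivity over [Fk E] ([exchange_vanishing]): each vanishing component
    is replaced by [x] or by [ortho x], in all possible ways.  This only enlarges
    the left-hand side.  A selection that ever picks an original component is
    harmless.  For one that picks only replaced components, let [m] be the
    selected infimum, and consider the replacement that puts [ortho x] at the
    indices where [m <= e x], and [x] elsewhere: whichever index is selected for
    it, [m] lies below both [e x] and [e (ortho x)], so [m] is [\bot]. *)

Set Implicit Arguments.
Unset Strict Implicit.
Unset Printing Implicit Defensive.

Import Order.TTheory.
Local Open Scope classical_set_scope.
Local Open Scope order_scope.

(** * Complete lattices and logics *)

Section CompleteLattice.
Context (d : Order.disp_t) (L : completeLatticeType d).
Implicit Types (S : set L) (x y : L).

Lemma csup_unique S x : supremums S x -> csup S = x.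
Proof.
move=> [ub lub]; apply/le_anti/andP; split; first by apply: csup_le; exact: ub.
by apply: lub => y; exact: csup_ub.
Qed.

Lemma cinf_unique S x : infimums S x -> cinf S = x.
Proof.
move=> [lb glb]; apply/le_anti/andP; split; last by apply: le_cinf; exact: lb.
by apply: glb => y; exact: cinf_lb.
Qed.

(** Selections here are functions of the index [i], whereas a choice function
    makes one choice per set, shared by all indices with the same
    [range (u i)].  Every choice function induces a selection, which is enough
    because the selections are only used to bound a supremum. *)
Lemma meet_join_exchange (SS : set (set L)) (I K : Type) (u : I -> K -> L) y :
    meet_join_distributive SS -> (forall i, SS (range (u i))) ->
    (forall g : I -> K, cinf (range (fun i => u i (g i))) <= y) ->
  cinf (range (fun i => csup (range (u i)))) <= y.
Proof.
move=> SSD uSS uy; pose TT : set (set L) := range (fun i => range (u i)).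
have TTSS : TT `<=` SS by move=> _ [i _ <-].
have -> : range (fun i => csup (range (u i))) = [set csup S | S in TT].
  by rewrite -image_comp.
rewrite SSD //; apply: csup_le => _ [f fTT <-].
have uTT i : range (u i) \in TT by apply/mem_set; exists i.
pose v i : TT := exist _ (range (u i)) (uTT i).
have fu i : exists k, u i k = f (v i) by have [k _ <-] := fTT (v i); exists k.
apply: le_trans (uy (fun i => sval (cid (fu i)))).
apply: le_cinf => _ [i _ <-]; case: cid => k /= ->.
by apply: cinf_lb; exists (v i).
Qed.

End CompleteLattice.

Section Logic.
Context (d : Order.disp_t) (L : logicType d).
Implicit Types (S : set L) (x y : L).

Lemma le_orthoC x y : x <= ortho y -> y <= ortho x.
Proof. by move=> xy; rewrite -[y]orthoK; exact: le_ortho. Qed.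

Lemma ortho_csup S : ortho (csup S) = cinf [set ortho x | x in S].
Proof.
apply/esym/cinf_unique; split=> [_ [x Sx <-]|y ylb].
  by apply: le_ortho; exact: csup_ub.
by apply: le_orthoC; apply: csup_le => x Sx; apply: le_orthoC; apply: ylb; exists x.
Qed.

Lemma ortho_cinf S : ortho (cinf S) = csup [set ortho x | x in S].
Proof.
rewrite -[RHS]orthoK ortho_csup image_comp; congr (ortho (cinf _)).
by rewrite -[LHS]image_id; apply: eq_imagel => x _ /=; rewrite orthoK.
Qed.

Lemma ortho_bot : ortho \bot = \top :> L.
Proof. by apply/eqP; rewrite -le1x; apply: le_orthoC; exact: le0x. Qed.

Lemma ortho_eq0 x : ortho x = \bot -> x = \top.
Proof. by move=> x0; rewrite -[x]orthoK x0 ortho_bot. Qed.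

End Logic.

Section Homomorphisms.
Context (d d' : Order.disp_t) (L : logicType d) (M : logicType d').
Implicit Types (f : L -> M).

Lemma logic_hom_le f x y : logic_hom f -> x <= y -> f x <= f y.
Proof.
move=> [fsup _ _ _ _] xy.
have <- : csup [set x; y] = y.
  apply: csup_unique; split=> [z [->//|->//]|z zub].
  by apply: zub; right.
by rewrite fsup; apply: csup_ub; exists x => //; left.
Qed.

(** Infima come from suprema by De Morgan, and the bounds are the supremum and
    the infimum of the empty set. *)
Lemma logic_hom_csup_ortho f :
    (forall S : set L, f (csup S) = csup (f @` S)) ->
    (forall x, f (ortho x) = ortho (f x)) ->
  logic_hom f.
Proof.
move=> fsup fortho.
have f0 : f \bot = \bot.
  have sup0 (d0 : Order.disp_t) (N : logicType d0) : csup set0 = \bot :> N.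
    by apply: csup_unique; split=> // z _; exact: le0x.
  by rewrite -sup0 fsup image_set0 sup0.
split=> //; last by rewrite -ortho_bot fortho f0 ortho_bot.
move=> S; rewrite -[cinf S]orthoK fortho ortho_cinf fsup ortho_csup.
congr cinf; rewrite !image_comp; apply: eq_imagel => x _ /=.
by rewrite fortho orthoK.
Qed.

End Homomorphisms.

(** * Product elements generate the tensor product *)

Section Generation.
Context (d : Order.disp_t) (kappa : Type) (E : kappa -> logicType d).

Lemma in_tensor_cinf (A : Fk E) :
  in_tensor A = cinf (range (fun a => tensor_inj (A a))).
Proof.
have single_ge a C : Fle C (toFk (single (A a))) -> C a <= A a.
  by move=> /(_ a) Ca; rewrite (le_trans Ca) // (le_trans (toFk_le _ _)) // single_in.
apply/esym/cinf_unique; split=> [_ [a _ <-]|y ylb].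
  apply/le_down => C /down_inDF CA; apply/down_inDF/(Fle_trans CA)/le_toFk => b.
  have [<-|ab] := pselect (a = b); first by rewrite single_in.
  by rewrite single_out // lex1.
apply/le_down => C yC; apply/down_inDF => a; apply: single_ge; apply/down_inDF.
have : y <= tensor_inj (A a) by apply: ylb; exists a.
by move=> /le_down; exact.
Qed.

(** The supremum in [DF E] of these product elements is already [x], hence
    closed, so the supremum in the tensor product is the same. *)
Lemma tensor_csup (x : tensor E) :
  x = csup [set in_tensor A | A in Defs.down (tensor_val x)].
Proof.
apply/esym/csup_unique; split=> [_ [A xA <-]|y yub]; apply/le_down => C.
  by move=> /down_inDF; exact: down_le.
move=> xC; have /le_down : in_tensor C <= y by apply: yub; exists C.
by apply; apply/down_inDF; exact: Fle_refl.
Qed.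

Lemma logic_hom_tensor_eq (d' : Order.disp_t) (T : logicType d')
    (s t : tensor E -> T) : logic_hom s -> logic_hom t ->
  (forall a (x : E a), s (tensor_inj x) = t (tensor_inj x)) -> s = t.
Proof.
move=> [ssup sinf _ _ _] [tsup tinf _ _ _] st; apply/funext => x.
rewrite (tensor_csup x) ssup tsup !image_comp.
congr csup; apply: eq_imagel => A _ /=.
rewrite in_tensor_cinf sinf tinf !image_comp.
by congr cinf; apply: eq_imagel => a _ /=.
Qed.

End Generation.

(** * Extending the embeddings *)

Section Extension.
Context (d d' : Order.disp_t) (kappa : Type) (E : kappa -> logicType d).
Context (T : logicType d') (e : forall a, E a -> T).
Hypothesis e_hom : forall a, logic_hom (@e a).

(** The Boolean [c a] decides between [x a] and its complement, so that [c]
    ranges over all ways of removing the zeros of [B]. *)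
Definition fill (x : forall a, E a) (B : forall a, E a) (c : kappa -> bool) a :
    E a :=
  if pselect (B a = \bot) then (if c a then x a else ortho (x a)) else B a.

Lemma exchange_vanishing (I : Type) (B : I -> forall a, E a) (x : forall a, E a) y :
    (forall a, x a <> \bot) -> (forall a, x a <> \top) ->
    meet_join_distributive [set S_ e (Fval A) | A in [set: Fk E]] ->
    (forall g : I -> kappa, cinf (range (fun i => e (B i (g i)))) <= y) ->
  cinf (range (fun i => csup (range (fun a => e (B i a))))) <= y.
Proof.
move=> x0 x1 SD By.
have fill_neq0 i c : ~ exists a, fill x (B i) c a = \bot.
  move=> [a]; rewrite /fill; case: pselect => //= _.
  by case: (c a) => [/x0|/ortho_eq0/x1].
have le_fill i c a : B i a <= fill x (B i) c a.
  by rewrite /fill; case: pselect => //= ->; exact: le0x.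
pose u (ic : I * (kappa -> bool)) a := e (fill x (B ic.1) ic.2 a).
apply: (@le_trans _ _ (cinf (range (fun ic => csup (range (u ic)))))).
  apply: le_cinf => _ [[i c] _ <-].
  apply: (@le_trans _ _ (csup (range (fun a => e (B i a))))).
    by apply: cinf_lb; exists i.
  apply: csup_le => _ [a _ <-].
  apply: (le_trans (logic_hom_le (e_hom a) (le_fill i c a))).
  by apply: csup_ub; exists a.
apply: (meet_join_exchange SD) => [[i c]|g].
  exists (toFk (fill x (B i) c)) => //; rewrite /S_ /u /=.
  by apply: eq_imagel => a _; rewrite toFk_id.
set m := cinf _.
have m_le i c : m <= u (i, c) (g (i, c)) by apply: cinf_lb; exists (i, c).
suff mB i : exists a, m <= e (B i a).
  apply: le_trans (By (fun i => sval (cid (mB i)))).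
  by apply: le_cinf => _ [i _ <-]; case: cid.
have [[c Bc]|all0] := pselect (exists c, B i (g (i, c)) <> \bot).
  exists (g (i, c)); have := m_le i c.
  by rewrite /u /fill /=; case: pselect.
exists (g (i, fun=> true)).
suff [a [ma moa]] : exists a, m <= e (x a) /\ m <= ortho (e (x a)).
  apply: (@le_trans _ _ \bot); last exact: le0x.
  by rewrite -(meetxo (e (x a))) lexI ma moa.
have m_fill c : m <= e (if c (g (i, c)) then x (g (i, c)) else ortho (x (g (i, c)))).
  have := m_le i c; rewrite /u /fill /=; case: pselect => //= Bc.
  by case: all0; exists c.
(* The diagonal replacement: [c] takes [ortho (x a)] exactly where [m <= e (x a)],
   so the index that [g] selects for [c] has both inequalities. *)
pose c a := ~~ `[< m <= e (x a) >].
have := m_fill c; case: ifPn => [/asboolPn//|/negPn/asboolP mx].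
by have [_ _ _ _ ->] := e_hom (g (i, c)); exists (g (i, c)).
Qed.

Definition product_value (B : forall a, E a) : T :=
  cinf (range (fun a => e (B a))).

Definition extension (X : DF E) : T :=
  csup [set product_value (Fval A) | A in Defs.down X].

Lemma product_value_le (B : forall a, E a) a : product_value B <= e (B a).
Proof. by apply: cinf_lb; exists a. Qed.

Lemma le_product_value (B C : forall a, E a) :
  (forall a, B a <= C a) -> product_value B <= product_value C.
Proof.
move=> BC; apply: le_cinf => _ [a _ <-].
exact: le_trans (product_value_le B a) (logic_hom_le (e_hom a) (BC a)).
Qed.

Lemma product_value_vanish (B : forall a, E a) a :
  B a = \bot -> product_value B = \bot.
Proof.
move=> Ba; apply/eqP; rewrite -lex0; have [_ _ <- _ _] := e_hom a.
by rewrite -Ba product_value_le.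
Qed.

Hypothesis kappa_neq0 : inhabited kappa.

Lemma product_value0 : product_value (Fk0 E) = \bot.
Proof. by have [a] := kappa_neq0; apply: (@product_value_vanish _ a). Qed.

(** Identifying the functions that vanish somewhere is harmless for the values
    in [T]. *)
Lemma product_value_toFk (B : forall a, E a) :
  product_value (toFk B) = product_value B.
Proof.
have [B0|nB] := pselect (exists a, B a = \bot).
  by rewrite toFk0 // product_value0; case: B0 => a /product_value_vanish ->.
by congr product_value; apply: functional_extensionality_dep; exact: toFk_id.
Qed.

Lemma extension_csup (S : set (DF E)) :
  extension (csup S) = csup [set extension X | X in S].
Proof.
apply: csup_unique; split=> [_ [A /down_sup[->|[X SX XA]] <-]|y yub].
- by rewrite product_value0 le0x.
- apply: (@le_trans _ _ (extension X)); first by apply: csup_ub; exists A.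
  by apply: csup_ub; exists X.
- apply: csup_le => _ [X SX <-]; apply: csup_le => _ [A XA <-].
  by apply: yub; exists A => //; apply/down_sup; right; exists X.
Qed.

Lemma extension_inDF A : extension (inDF A) = product_value A.
Proof.
apply: csup_unique; split=> [_ [C /down_inDF CA <-]|y yub].
  exact: le_product_value.
by apply: yub; exists A => //; apply/down_inDF; exact: Fle_refl.
Qed.

Lemma extension_tensor_inj a (x : E a) : extension (tensor_inj x) = e x.
Proof.
rewrite extension_inDF product_value_toFk.
apply: cinf_unique; split=> [_ [b _ <-]|y ylb].
  have [<-|ab] := pselect (a = b); first by rewrite single_in.
  by rewrite single_out //; have [_ _ _ -> _] := e_hom b; exact: lex1.
by apply: ylb; exists a => //; rewrite single_in.
Qed.

Lemma extension_star_le X : extension (star X) <= ortho (extension X).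
Proof.
apply: csup_le => _ [C /down_star[->|CX] <-]; first by rewrite product_value0 le0x.
apply: le_orthoC; apply: csup_le => _ [A XA <-]; apply: le_orthoC.
have [->|[a Ca]] := CX A XA; first by rewrite product_value0 ortho_bot lex1.
apply: le_trans (le_ortho _ _ (product_value_le A a)).
have [_ _ _ _ <-] := e_hom a.
exact: le_trans (product_value_le C a) (logic_hom_le (e_hom a) Ca).
Qed.

Hypothesis exchange : forall (I : Type) (B : I -> forall a, E a) y,
    (forall g : I -> kappa, cinf (range (fun i => e (B i (g i)))) <= y) ->
  cinf (range (fun i => csup (range (fun a => e (B i a))))) <= y.

(** The inequality that needs distributivity: the product elements obtained
    from the exchange are those in the formula defining [star X]. *)
Lemma extension_star X : extension (star X) = ortho (extension X).
Proof.
apply/le_anti; rewrite extension_star_le andTb.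
pose I := {A : Fk E | Defs.down X A}; pose B (i : I) a := ortho (sval i a).
apply: (@le_trans _ _ (cinf (range (fun i => csup (range (fun a => e (B i a))))))).
  apply: le_cinf => _ [[A XA] _ <-].
  have -> : csup (range (fun a => e (ortho (A a)))) = ortho (product_value A).
    rewrite ortho_cinf image_comp; congr csup; apply: eq_imagel => a _ /=.
    by have [_ _ _ _ ->] := e_hom a.
  by apply: le_ortho; apply: csup_ub; exists A.
apply: exchange => g.
(* The product element obtained by grouping the [i] with the same [g i]. *)
pose C a := cinf [set B i a | i in [set i | g i = a]].
apply: (@le_trans _ _ (product_value C)).
  apply: le_cinf => _ [a _ <-]; have [_ einf _ _ _] := e_hom a.
  rewrite einf; apply: le_cinf => _ [_ [i gi <-] <-].
  by apply: cinf_lb; exists i => //; rewrite gi.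
rewrite -product_value_toFk; apply: csup_ub; exists (toFk C) => //.
apply/down_star; right=> A XA; right; pose i : I := exist _ A XA.
exists (g i); apply: le_trans (toFk_le _ _) _.
by apply: cinf_lb; exists i.
Qed.

(** A supremum in the tensor product is the double [star] of the one in [DF E],
    and the double orthocomplement in [T] is the identity. *)
Lemma extension_logic_hom : logic_hom (fun x : tensor E => extension x).
Proof.
apply: logic_hom_csup_ortho => [S|x]; last exact: extension_star.
rewrite [LHS]extension_star extension_star orthoK.
by rewrite extension_csup image_comp.
Qed.

End Extension.

Theorem theorem35 (d d' : Order.disp_t) (kappa : Type)
  (kappa_neq0 : inhabited kappa)
  (E : kappa -> logicType d) (T : logicType d')
  (e : forall a : kappa, E a -> T)
  (e_embedding : forall a : kappa, logic_embedding (@e a))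
  (S_distributive :
     meet_join_distributive [set S_ e (Fval A) | A in [set: Fk E]])
  (S_distributive_two_valued :
     (exists a : kappa, forall x : E a, x = \bot \/ x = \top) ->
     meet_join_distributive [set S_ e A | A in [set: forall a : kappa, E a]]) :
  exists! t : tensor E -> T,
    logic_hom t /\
    forall (a : kappa) (x : E a), t (tensor_inj x) = e a x.
Proof.
have e_hom a : logic_hom (@e a) by case: (e_embedding a).
have exchange (I : Type) (B : I -> forall a, E a) y :
    (forall g : I -> kappa, cinf (range (fun i => e _ (B i (g i)))) <= y) ->
  cinf (range (fun i => csup (range (fun a => e _ (B i a))))) <= y.
  have [/S_distributive_two_valued SD|many] :=
    pselect (exists a, forall x : E a, x = \bot \/ x = \top).
    by apply: (meet_join_exchange SD) => i; exists (B i).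
  have many_valued a : exists x : E a, x <> \bot /\ x <> \top.
    apply: contra_notP many => none; exists a => x.
    have [->|x0] := pselect (x = \bot); first by left.
    have [->|x1] := pselect (x = \top); first by right.
    by case: none; exists x.
  apply: (@exchange_vanishing _ _ _ _ _ _ e_hom I B
    (fun a => sval (cid (many_valued a))) y) => // a; by case: cid => x [].
have ext_hom := extension_logic_hom e_hom kappa_neq0 exchange.
have ext_inj := extension_tensor_inj e_hom kappa_neq0.
exists (fun x => extension e x); split=> // s [s_hom s_inj].
by apply: logic_hom_tensor_eq => // a x; rewrite s_inj ext_inj.
Qed.
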